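(* For all $n\ge2$, the map $\psi$ is a bijection from the set of 1-terminal chord diagrams of size $n$ to the set of all (not necessarily connected) chord diagrams of size $n-1$.
   Context: A chord diagram of size $n$ is a perfect matching of $\{1,\dots,2n\}$; chords are ordered pairs $(a,b)$ with $a<b$, $a$ the source and $b$ the sink. For chords $c_1=(a_1,b_1)$, $c_2=(a_2,b_2)$ with $a_1<a_2$, they cross if $a_2<b_1<b_2$, and then $c_2$ is a right neighbor of $c_1$. A chord is terminal if it has no right neighbors. A diagram is 1-terminal if no chord other than the last one, in the order of sources, is terminal. The map $\psi$: let $T$ be a 1-terminal diagram of size $n\ge2$ with chords $c_1<\dots<c_n$ ordered by source. The source-sink group of a chord $c$ consists of the source of $c$ together with the maximal run of consecutive sinks immediately following it (excluding the sink of $c$ itself). Then $\psi(T)$ is the diagram obtained from $T$ by (1) moving each source to the end of its source-sink group (all other endpoints keeping their relative order and every source staying paired with its sink), and (2) deleting the terminal chord $c_n$; endpoints are then relabelled order-preservingly. *)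

(* Defs.v *)
From mathcomp Require Import all_boot.

Set Implicit Arguments.
Unset Strict Implicit.
Unset Printing Implicit Defensive.

(* The endpoints are numbered 0, ..., 2n - 1 instead of 1, ..., 2n. *)
Notation point n := 'I_(n.*2).
Notation chord n := (point n * point n)%type.

Definition chord_diagram n (T : {set chord n}) : bool :=
  [forall c in T, c.1 < c.2] &&
  [forall x : point n, #|[set c in T | (c.1 == x) || (c.2 == x)]| == 1].

Definition right_neighbor n (c d : chord n) : bool :=
  [&& c.1 < d.1, d.1 < c.2 & c.2 < d.2].

Definition terminal n (T : {set chord n}) (c : chord n) : bool :=
  [forall d in T, ~~ right_neighbor c d].

Definition last_chord n (T : {set chord n}) (c : chord n) : bool :=
  (c \in T) && [forall d in T, d.1 <= c.1].

Definition one_terminal n (T : {set chord n}) : bool :=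
  chord_diagram T && [forall c in T, terminal T c ==> last_chord T c].

Definition is_sink n (T : {set chord n}) (x : point n) : bool :=
  [exists c in T, c.2 == x].

(* The run of sinks stops in front of the sink of c itself. In a 1-terminal
   diagram this only matters for the last chord: any other chord has a right
   neighbor, whose source separates its source from its sink. *)
Definition source_sink_group n (T : {set chord n}) (c : chord n) :
    {set point n} :=
  [set y : point n | (c.1 <= y) &&
    [forall z : point n, (c.1 < z <= y) ==> is_sink T z && (z != c.2)]].

Definition group_end n (T : {set chord n}) (c : chord n) : nat :=
  \max_(y in source_sink_group T c) y.

(* Sorting the endpoints by increasing [slot] carries out step (1): a sink x
   stays at slot 2x, and a source goes to slot 2e + 1, just after the last
   element e of its source-sink group and before the point e + 1. *)
Definition slot n (T : {set chord n}) (x : point n) : nat :=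
  if [pick c in T | c.1 == x] is Some c then (group_end T c).*2.+1 else x.*2.

Definition deleted n (T : {set chord n}) (x : point n) : bool :=
  [exists c in T, last_chord T c && ((x == c.1) || (x == c.2))].

(* The label of x after moving the sources, deleting the last chord and
   relabelling the remaining endpoints in an order-preserving way. *)
Definition new_label n (T : {set chord n}) (x : point n) : nat :=
  #|[set y : point n | ~~ deleted T y & slot T y < slot T x]|.

Definition psi n (T : {set chord n}) : {set chord n.-1} :=
  [set p : chord n.-1 |
    [exists c in T, [&& ~~ last_chord T c,
                        p.1 == new_label T c.1 :> nat &
                        p.2 == new_label T c.2 :> nat]]].

(* Main.v *)
(* Number endpoints from 0. List the sources of a 1-terminal diagram T as s_1 < ... < s_n and let b_i be
   the sink paired with s_i. Being 1-terminal amounts to s_(i+1) < b_i for i < n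
   together with b_n = 2n - 1. Moving s_i to the end of its group puts it just
   in front of s_(i+1), so after deleting c_n and relabelling, psi T consists of
   the chords (s_(i+1) - 1, b_i - 1) for i < n. This is inverted by prepending a
   source at 0, pairing each source with the sink formerly paired with the next
   source, and pairing the last source with 2n - 1. *)
Require Import Defs.
From mathcomp Require Import all_boot.
From mathcomp Require Import zify.

Set Implicit Arguments.
Unset Strict Implicit.
Unset Printing Implicit Defensive.

(** Evaluates the count to which [new_label] reduces, by means of the bijection [i -> i + 1] from
    ['I_k.-1]. *)
Lemma card_ord_between0 m (k : 'I_m) : #|[set i : 'I_m | 0 < i < k]| = k.-1.
Proof.
have lt_m (i : 'I_k.-1) : i.+1 < m.
  by have := ltn_ord i; have := ltn_ord k; lia.
have -> : [set i : 'I_m | 0 < i < k] = [set Ordinal (lt_m i) | i : 'I_k.-1].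
  apply/setP=> i; rewrite inE; apply/idP/imsetP => [i_in|[j _ ->] /=].
    have ik : i.-1 < k.-1 by lia.
    by exists (Ordinal ik) => //; apply: val_inj => /=; lia.
  by have := ltn_ord j; lia.
rewrite card_imset ?card_ord // => i j /(congr1 val) /= /eqP.
by rewrite eqSS => /eqP/val_inj.
Qed.

(** * Consecutive elements of a set of ordinals *)

Section Consecutive.

Variables (m : nat) (S : {set 'I_m}).
Implicit Types x y z : 'I_m.

Definition consecutive x y : bool :=
  [&& x \in S, y \in S, x < y & [forall z in S, (z <= x) || (y <= z)]].

Lemma consecutiveP x y :
  reflect [/\ x \in S, y \in S, x < y
            & forall z, z \in S -> (z <= x) || (y <= z)]
          (consecutive x y).
Proof.
apply: (iffP and4P) => -[xS yS xy H]; split=> //; first exact/forall_inP.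
exact/forall_inP.
Qed.

Lemma consecutive_next x z :
  x \in S -> z \in S -> x < z -> exists y, consecutive x y.
Proof.
move=> xS zS xz.
have Pz : (z \in S) && (x < z) by rewrite zS.
case: (@arg_minnP _ z (fun y => (y \in S) && (x < y)) val Pz) => y /andP[yS xy] ymin.
exists y; apply/consecutiveP; split=> // u uS.
by case: leqP => //= xu; apply: ymin; rewrite uS.
Qed.

Lemma consecutive_prev z y :
  z \in S -> y \in S -> z < y -> exists x, consecutive x y.
Proof.
move=> zS yS zy.
have Pz : (z \in S) && (z < y) by rewrite zS.
case: (@arg_maxnP _ z (fun x => (x \in S) && (x < y)) val Pz) => x /andP[xS xy] xmax.
exists x; apply/consecutiveP; split=> // u uS.
by rewrite orbC; case: leqP => //= uy; apply: xmax; rewrite uS.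
Qed.

Lemma consecutive_injr x y y' : consecutive x y -> consecutive x y' -> y = y'.
Proof.
move=> /consecutiveP[_ yS xy H] /consecutiveP[_ y'S xy' H'].
by apply: val_inj => /=; have := H _ y'S; have := H' _ yS; lia.
Qed.

Lemma consecutive_injl x x' y : consecutive x y -> consecutive x' y -> x = x'.
Proof.
move=> /consecutiveP[xS _ xy H] /consecutiveP[x'S _ x'y H'].
by apply: val_inj => /=; have := H _ x'S; have := H' _ xS; lia.
Qed.

End Consecutive.

(** * Sources, sinks and deleted endpoints of a chord diagram *)

Lemma chord_diagramP n (T : {set chord n}) :
  reflect [/\ forall c, c \in T -> c.1 < c.2,
              forall x, exists2 c, c \in T & (c.1 == x) || (c.2 == x)
            & forall c d x, c \in T -> d \in T ->
                (c.1 == x) || (c.2 == x) -> (d.1 == x) || (d.2 == x) -> c = d]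
          (chord_diagram T).
Proof.
apply: (iffP andP) => [[/forall_inP lt12 /forallP card1]|[lt12 ex uniq]].
  split=> // [x|c d x cT dT cx dx]; have /cards1P[e eE] := card1 x.
    by have := set11 e; rewrite -eE inE => /andP[eT ex]; exists e.
  have: c \in [set e] by rewrite -eE inE cT.
  have: d \in [set e] by rewrite -eE inE dT.
  by rewrite !inE => /eqP-> /eqP->.
split; first exact/forall_inP.
apply/forallP=> x; have [c cT cx] := ex x.
apply/cards1P; exists c; apply/setP=> d; rewrite !inE.
apply/andP/eqP => [[dT dx]|->//]; exact: (uniq d c x).
Qed.

Definition sources n (T : {set chord n}) : {set point n} := [set c.1 | c in T].

Lemma last_chordP n (T : {set chord n}) (c : chord n) :
  reflect (c \in T /\ forall x, x \in sources T -> x <= c.1) (last_chord T c).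
Proof.
apply: (iffP andP) => -[cT H]; split=> //.
  by move=> _ /imsetP[d dT ->]; apply: (forall_inP H).
by apply/forall_inP=> d dT; apply/H/imset_f.
Qed.

Section ChordDiagram.

Variables (n : nat) (T : {set chord n}).
Hypothesis diagT : chord_diagram T.
Implicit Types (c d : chord n) (x y : point n).

Lemma chord_lt c : c \in T -> c.1 < c.2.
Proof. by case/chord_diagramP: diagT => H _ _; apply: H. Qed.

Lemma source_lt_max c : c \in T -> c.1 < n.*2.-1.
Proof. by move=> /chord_lt c12; have := ltn_ord c.2; lia. Qed.

Lemma source_inj : {in T &, injective fst}.
Proof.
case/chord_diagramP: diagT => _ _ H c d cT dT /eqP cd.
by apply: (H c d d.1); rewrite ?cd ?eqxx.
Qed.

Lemma sink_inj : {in T &, injective snd}.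
Proof.
case/chord_diagramP: diagT => _ _ H c d cT dT /eqP cd.
by apply: (H c d d.2); rewrite ?cd ?eqxx ?orbT.
Qed.

Lemma sink_notin_sources c : c \in T -> c.2 \notin sources T.
Proof.
case/chord_diagramP: diagT => H1 _ H2 cT; apply/imsetP => -[d dT cd].
have E : c = d by apply: (H2 c d c.2); rewrite // ?cd eqxx ?orbT.
by have := H1 d dT; rewrite -{2}E cd ltnn.
Qed.

Lemma notin_sources_sink x : x \notin sources T -> exists2 c, c \in T & c.2 = x.
Proof.
case/chord_diagramP: diagT => _ H _ xS; have [c cT /orP[]/eqP cx] := H x.
  by rewrite -cx imset_f in xS.
by exists c.
Qed.

Lemma is_sinkE x : is_sink T x = (x \notin sources T).
Proof.
apply/exists_inP/idP => [[c cT /eqP<-]|/notin_sources_sink[c cT <-]].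
  exact: sink_notin_sources.
by exists c.
Qed.

(** A sink exceeds the source of its chord, so it is positive. With 0 at the bottom of the source
    set, every positive source has a predecessor there. *)
Lemma sources0 x : x = 0 :> nat -> x \in sources T.
Proof.
move=> x0; apply: contraT => /notin_sources_sink[c /chord_lt cT cx].
by rewrite cx x0 in cT.
Qed.

Lemma last_chord_uniq c d : last_chord T c -> last_chord T d -> c = d.
Proof.
move=> /last_chordP[cT Hc] /last_chordP[dT Hd]; apply: source_inj => //.
by apply/val_inj/eqP; rewrite /= eqn_leq Hd ?Hc ?imset_f.
Qed.

Lemma deleted_source c : c \in T -> deleted T c.1 = last_chord T c.
Proof.
move=> cT; apply/exists_inP/idP => [[d dT /andP[ld /orP[]/eqP E]]|lc].
- by rewrite (source_inj cT dT E).
- by have := sink_notin_sources dT; rewrite -E imset_f.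
- by exists c; rewrite // lc eqxx.
Qed.

Lemma deleted_sink c : c \in T -> deleted T c.2 = last_chord T c.
Proof.
move=> cT; apply/exists_inP/idP => [[d dT /andP[ld /orP[]/eqP E]]|lc].
- by have := sink_notin_sources cT; rewrite E imset_f.
- by rewrite (sink_inj cT dT E).
- by exists c; rewrite // lc eqxx orbT.
Qed.

Lemma next_source c : c \in T -> ~~ last_chord T c ->
  exists y, consecutive (sources T) c.1 y.
Proof.
move=> cT; rewrite /last_chord cT /= => /forall_inPn[d dT].
by rewrite -ltnNge => cd; apply: (@consecutive_next _ _ _ d.1); rewrite ?imset_f.
Qed.

Lemma consecutive_not_last c y :
  consecutive (sources T) c.1 y -> ~~ last_chord T c.
Proof.
move=> /consecutiveP[_ yS cy _]; apply/negP => /last_chordP[_ /(_ _ yS)].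
by rewrite leqNgt cy.
Qed.

End ChordDiagram.

(** A stand-in for the position after step (1): a moved source lands just before the next source, so
    in relative order it takes the place of that source. The default [x] serves the sinks, which do
    not move; it is also returned at the last source, which gets deleted. *)
Definition shift n (T : {set chord n}) (x : point n) : point n :=
  odflt x [pick y | consecutive (sources T) x y].

Lemma shift_consecutive n (T : {set chord n}) (x y : point n) :
  consecutive (sources T) x y -> shift T x = y.
Proof.
rewrite /shift => xy; case: pickP => [z xz|/(_ y)]; last by rewrite xy.
exact: consecutive_injr xz xy.
Qed.

Lemma shift_id n (T : {set chord n}) (x : point n) :
  x \notin sources T -> shift T x = x.
Proof.
rewrite /shift; case: pickP => //= y /consecutiveP[xS _ _ _].
by rewrite xS.
Qed.

Lemma raise_subproof n (x : point n.-1) : x.+1 < n.*2.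
Proof. by have := ltn_ord x; lia. Qed.

(** Undoes the relabelling: the undeleted points occupy the positions 1 to 2n - 2 after [shift], and
    label [x] belongs to position [x + 1]. *)
Definition raise n (x : point n.-1) : point n := Ordinal (raise_subproof x).

Lemma raise_inj n : injective (@raise n).
Proof. by move=> x y /(congr1 val) /= [] /val_inj. Qed.

Lemma raise_lt_max n (x : point n.-1) : raise x < n.*2.-1.
Proof. by have := ltn_ord x; rewrite /=; lia. Qed.

Lemma raiseP n (x : point n) :
  0 < x -> x < n.*2.-1 -> exists y : point n.-1, raise y = x.
Proof.
move=> x0 xmax; have xn : x.-1 < n.-1.*2 by lia.
by exists (Ordinal xn); apply: val_inj; rewrite /= prednK.
Qed.

(** * The effect of [psi] on a 1-terminal diagram *)

Section OneTerminal.

Variables (n : nat) (T : {set chord n}).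
Hypothesis termT : one_terminal T.
Implicit Types (c d : chord n) (x y : point n).

Lemma one_terminal_diagram : chord_diagram T.
Proof. by case/andP: termT. Qed.

Let diagT := one_terminal_diagram.

(** No sink lies beyond the top point, so the chord ending there has no right neighbor; being
    terminal, it is the last chord. *)
Lemma last_chord_sink c : last_chord T c -> c.2 = n.*2.-1 :> nat.
Proof.
move=> lc; have n2 : n.*2.-1 < n.*2 by have := ltn_ord c.1; lia.
pose z : point n := Ordinal n2.
have zmax (x : point n) : x <= z by rewrite /=; have := ltn_ord x; lia.
have [e eT ez] : exists2 e, e \in T & e.2 = z.
  apply: notin_sources_sink => //; apply/imsetP => -[d dT zd].
  by have := chord_lt diagT dT; rewrite -zd ltnNge zmax.
have le : last_chord T e.
  case/andP: termT => _ /forall_inP/(_ e eT)/implyP; apply.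
  apply/forall_inP=> d dT; rewrite /right_neighbor ez [z < _]ltnNge zmax.
  by rewrite !andbF.
by rewrite (last_chord_uniq diagT lc le) ez.
Qed.

(** A chord followed by another source is not last, hence has a right neighbor. The source of that
    neighbor lies before the sink of [c], and the next source comes no later. *)
Lemma next_source_lt_sink c y :
  c \in T -> consecutive (sources T) c.1 y -> y < c.2.
Proof.
move=> cT cy; have Nl := consecutive_not_last cy.
have Nt : ~~ terminal T c.
  apply: contra Nl => tc.
  by case/andP: termT => _ /forall_inP/(_ c cT)/implyP; apply.
have /forall_inPn[d dT] := Nt; rewrite negbK => /and3P[cd dc _].
have /consecutiveP[_ _ _ /(_ d.1)] := cy.
rewrite imset_f // leqNgt cd => /(_ isT) yd; exact: leq_ltn_trans yd dc.
Qed.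

Lemma sink_lt_max c : c \in T -> ~~ last_chord T c -> c.2 < n.*2.-1.
Proof.
move=> cT Nl; have n0 : 0 < n by have := ltn_ord c.1; lia.
have [d ld] : exists d, last_chord T d.
  case: (@arg_maxnP _ c (mem T) (fun e => e.1) cT) => d dT dmax.
  by exists d; apply/andP; split=> //; apply/forall_inP.
have dmax := last_chord_sink ld; rewrite ltn_neqAle.
have -> : c.2 <= n.*2.-1 by have := ltn_ord c.2; lia.
rewrite andbT; apply: contra Nl => /eqP cmax.
rewrite (_ : c = d) //; apply: (sink_inj diagT) => //.
  by case/andP: ld.
by apply: val_inj; rewrite /= cmax dmax.
Qed.

(** Only sinks lie strictly between consecutive sources, and the sink of [c] itself comes after [y].
    The group is therefore the whole interval from [c.1] to [y - 1]. *)
Lemma group_end_consecutive c y :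
  c \in T -> consecutive (sources T) c.1 y -> group_end T c = y.-1.
Proof.
move=> cT cy; have ylt := next_source_lt_sink cT cy.
have /consecutiveP[cS yS lty Hy] := cy.
have gE z : (z \in source_sink_group T c) = (c.1 <= z < y).
  rewrite inE; case: (leqP c.1 z) => //= cz; apply/forallP/idP => [/(_ y)|zy u].
    by rewrite lty is_sinkE // yS /= implybF -ltnNge.
  apply/implyP=> /andP[cu uz]; rewrite is_sinkE //; apply/andP; split.
    apply/negP => /Hy; case/orP; rewrite leqNgt; first by rewrite cu.
    by rewrite (leq_ltn_trans uz zy).
  by apply: contraTneq uz => ->; lia.
have py : y.-1 < n.*2 by have := ltn_ord y; lia.
apply/eqP; rewrite eqn_leq; apply/andP; split.
  by apply/bigmax_leqP => z; rewrite gE; lia.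
apply: (@leq_bigmax_cond _ _ (@nat_of_ord n.*2) (Ordinal py)).
by rewrite gE /=; lia.
Qed.

(** For a source, the group ends at [y - 1], so its slot is 2(y - 1) + 1 = 2y - 1, immediately below
    the even slot 2y. *)
Variant undeleted_spec x : Prop :=
| UndeletedSource c y of c \in T & x = c.1 & consecutive (sources T) x y
    & shift T x = y & slot T x = y.*2.-1
| UndeletedSink c of c \in T & x = c.2 & x \notin sources T
    & ~~ last_chord T c & shift T x = x & slot T x = x.*2.

Lemma undeletedP x : ~~ deleted T x -> undeleted_spec x.
Proof.
have [/imsetP[c cT ->]|xS] := boolP (x \in sources T).
  rewrite deleted_source // => Nl; have [y cy] := next_source cT Nl.
  apply: (UndeletedSource cT (erefl _) cy); first exact: shift_consecutive.
  rewrite /slot; case: pickP => [d /andP[dT /eqP dc]|/(_ c)]; last first.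
    by rewrite cT eqxx.
  rewrite (source_inj diagT dT cT dc) (group_end_consecutive cT cy).
  by have /consecutiveP[_ _ ? _] := cy; lia.
have [c cT cx] := notin_sources_sink diagT xS; rewrite -cx deleted_sink // => Nl.
apply: (UndeletedSink cT) => //; rewrite ?cx //; first exact: shift_id.
rewrite /slot; case: pickP => [d /andP[dT /eqP dx]|//].
by rewrite -dx imset_f in xS.
Qed.

Lemma shift_sources x : ~~ deleted T x ->
  (shift T x \in sources T) = (x \in sources T).
Proof.
case/undeletedP => [c y cT _ /consecutiveP[xS yS _ _] -> _|c _ _ _ _ -> //].
by rewrite xS yS.
Qed.

Lemma slot_shift x : ~~ deleted T x ->
  slot T x = (shift T x).*2 - (x \in sources T).
Proof.
case/undeletedP => [c y _ _ /consecutiveP[-> _ _ _] -> ->|c _ _ /negPf-> _ -> ->];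
  lia.
Qed.

(** A slot is twice the shifted point, less 1 for a source. Distinct shifted points have doubles at
    least 2 apart, so this correction cannot reverse their order; equal ones are both sources or
    both sinks, and then the slots agree. *)
Lemma slot_shift_lt x y : ~~ deleted T x -> ~~ deleted T y ->
  (slot T x < slot T y) = (shift T x < shift T y).
Proof.
move=> Nx Ny; rewrite !slot_shift // -(shift_sources Nx) -(shift_sources Ny).
have [->|/eqP ne] := eqVneq (shift T x) (shift T y); first by rewrite !ltnn.
have {ne} : shift T x <> shift T y :> nat by move/val_inj.
by case: (shift T x \in _); case: (shift T y \in _) => /=; lia.
Qed.

Lemma shift_inj : {in [pred x | ~~ deleted T x] &, injective (shift T)}.
Proof.
move=> x y; rewrite !inE => Nx Ny E.
have := shift_sources Nx; rewrite E shift_sources //.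
case/undeletedP: Nx E => [c z _ _ xz -> _|c _ _ /negPf xS _ -> _];
  case/undeletedP: Ny => [d u _ _ yu -> _|d _ _ /negPf yS _ -> _] E //.
- by move=> _; rewrite -E in yu; apply: consecutive_injl xz yu.
- by case/consecutiveP: xz => ->; rewrite yS.
- by case/consecutiveP: yu => ->; rewrite xS.
Qed.

Lemma shift_gt0 x : ~~ deleted T x -> 0 < shift T x.
Proof.
case/undeletedP => [c y _ _ /consecutiveP[_ _ xy _] -> _|c cT -> _ _ -> _].
  by lia.
by have := chord_lt diagT cT; lia.
Qed.

Lemma shift_lt_max x : ~~ deleted T x -> shift T x < n.*2.-1.
Proof.
case/undeletedP => [c y _ _ /consecutiveP[_ /imsetP[d dT ->] _ _] -> _|].
  exact: (source_lt_max diagT dT).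
by move=> c cT -> _ Nl -> _; apply: sink_lt_max.
Qed.

(** A source is reached from its predecessor, which exists since 0 is a source. A sink is reached
    from itself, and it survives because the deleted sink is 2n - 1. *)
Lemma shift_surj (z : point n) : 0 < z -> z < n.*2.-1 ->
  exists2 x, ~~ deleted T x & shift T x = z.
Proof.
move=> z0 zmax; have [zS|zS] := boolP (z \in sources T).
  have n0 : 0 < n.*2 by lia.
  have [x xz] : exists x, consecutive (sources T) x z.
    by apply: (@consecutive_prev _ _ (Ordinal n0)) => //; exact: (sources0 diagT).
  exists x; last exact: shift_consecutive.
  have /consecutiveP[/imsetP[c cT xc] _ _ _] := xz; rewrite xc in xz *.
  by rewrite deleted_source // (consecutive_not_last xz).
exists z; last exact: shift_id.
have [c cT cz] := notin_sources_sink diagT zS; rewrite -cz deleted_sink //.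
by apply: contraTN zmax => /last_chord_sink; rewrite cz => ->; rewrite ltnn.
Qed.

(* [shift] maps the undeleted points in slot order onto [1 .. 2n - 2]. *)
Lemma new_labelE x : ~~ deleted T x -> new_label T x = (shift T x).-1.
Proof.
move=> Nx; rewrite /new_label.
set A := [set _ | _].
rewrite -(@card_in_imset _ _ (shift T) A); last first.
  by move=> y z; rewrite !inE => /andP[Ny _] /andP[Nz _]; apply: shift_inj.
have -> : shift T @: A = [set z : point n | 0 < z < shift T x].
  apply/setP=> z; rewrite inE; apply/imsetP/andP => [[y]|[z0 zx]].
    by rewrite inE => /andP[Ny]; rewrite slot_shift_lt // => yx ->; rewrite shift_gt0.
  have [y Ny yz] := shift_surj z0 (ltn_trans zx (shift_lt_max Nx)).
  by exists y; rewrite // inE Ny slot_shift_lt // yz.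
exact: card_ord_between0.
Qed.

(** Frees [psi] from slots and labels: by [new_labelE], the label of a source is its next source
    minus 1, and that of a sink is the sink minus 1. All later arguments rest on this form. *)
Lemma psiP (p : chord n.-1) :
  reflect (exists2 c : chord n, c \in T &
             consecutive (sources T) c.1 (raise p.1) /\ c.2 = raise p.2)
          (p \in psi T).
Proof.
rewrite inE; apply: (iffP exists_inP) => -[c cT H]; exists c => //.
  case/and3P: H => Nl /eqP p1 /eqP p2; have [y cy] := next_source cT Nl.
  split.
    rewrite (_ : raise p.1 = y) //; apply: val_inj.
    rewrite /= p1 new_labelE ?deleted_source // (shift_consecutive cy).
    by have /consecutiveP[_ _ ? _] := cy; lia.
  apply: val_inj; rewrite /= p2 new_labelE ?deleted_sink //.
  rewrite shift_id ?sink_notin_sources //.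
  by rewrite prednK // (leq_ltn_trans _ (chord_lt diagT cT)).
case: H => cy cp; have Nl := consecutive_not_last cy.
rewrite Nl !new_labelE ?deleted_source ?deleted_sink //.
by rewrite (shift_consecutive cy) shift_id ?sink_notin_sources // cp !eqxx.
Qed.

Lemma psi_next_source c : c \in T -> ~~ last_chord T c ->
  exists2 p, p \in psi T &
    consecutive (sources T) c.1 (raise p.1) /\ c.2 = raise p.2.
Proof.
move=> cT Nl; have [y cy] := next_source cT Nl.
have [r rE] : exists r, raise r = c.2.
  by apply: raiseP (sink_lt_max cT Nl); apply: leq_ltn_trans (chord_lt diagT cT).
have [q qE] : exists q, raise q = y.
  apply: raiseP; case/consecutiveP: cy => _ /imsetP[d dT ->] cd _.
    exact: leq_ltn_trans cd.
  exact: (source_lt_max diagT dT).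
by exists (q, r); [apply/psiP; exists c | ]; rewrite //= qE rE.
Qed.

Lemma psi_source (x : point n.-1) : raise x \in sources T ->
  exists2 p, p \in psi T & p.1 = x.
Proof.
move=> xS; have n0 : 0 < n.*2 by have := ltn_ord (raise x); lia.
have [z zx] : exists z, consecutive (sources T) z (raise x).
  by apply: (@consecutive_prev _ _ (Ordinal n0)) => //; exact: (sources0 diagT).
have /consecutiveP[/imsetP[c cT zc] _ _ _] := zx; rewrite zc in zx.
have [p pT [cp _]] := psi_next_source cT (consecutive_not_last zx).
by exists p => //; apply: raise_inj; apply: consecutive_injr cp zx.
Qed.

Lemma psi_sink (x : point n.-1) : raise x \notin sources T ->
  exists2 p, p \in psi T & p.2 = x.
Proof.
move=> xS; have [c cT cx] := notin_sources_sink diagT xS.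
have Nl : ~~ last_chord T c.
  apply/negP => /last_chord_sink; rewrite cx => E.
  by have := raise_lt_max x; rewrite E ltnn.
have [p pT [_ cp]] := psi_next_source cT Nl.
by exists p => //; apply: raise_inj; rewrite -cp.
Qed.

Lemma psi_chord_diagram : chord_diagram (psi T).
Proof.
apply/chord_diagramP; split=> [p /psiP[c cT [cp cE]]|x|].
- by have := next_source_lt_sink cT cp; rewrite cE.
- have [/psi_source|/psi_sink] := boolP (raise x \in sources T).
    by case=> p pT px; exists p; rewrite ?px ?eqxx.
  by case=> p pT px; exists p; rewrite ?px ?eqxx ?orbT.
(* First endpoints raise to sources of [T] and second endpoints to sinks, so a shared endpoint has
   the same role in both chords. *)
have cross p q : p \in psi T -> q \in psi T -> p.1 != q.2.
  move=> /psiP[c cT [/consecutiveP[_ pS _ _] _]] /psiP[d dT [_ dq]].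
  apply/eqP => pq; have := sink_notin_sources diagT dT.
  by rewrite dq -pq pS.
move=> p q x pT qT.
have /psiP[c cT [cp cE]] := pT; have /psiP[d dT [dq dE]] := qT.
case/orP=> /eqP<- /orP[]/eqP qp.
- rewrite qp in dq; have cd := consecutive_injl cp dq.
  rewrite (source_inj diagT cT dT cd) dE in cE.
  by apply: injective_projections; [rewrite qp | apply: raise_inj].
- by have := cross _ _ pT qT; rewrite qp eqxx.
- by have := cross _ _ qT pT; rewrite qp eqxx.
- rewrite -qp -dE in cE; rewrite (sink_inj diagT cT dT cE) in cp.
  apply: injective_projections; last by rewrite qp.
  by apply: raise_inj; apply: consecutive_injr cp dq.
Qed.

End OneTerminal.

(** * The candidate inverse [psi_inv], and why it is a left inverse *)

Definition raised_sources n (D : {set chord n.-1}) : {set point n} :=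
  [set x : point n | (x == 0 :> nat) || [exists p in D, raise p.1 == x]].

Definition psi_inv n (D : {set chord n.-1}) : {set chord n} :=
  [set c : chord n | (c.1 \in raised_sources D) &&
    ((c.2 == n.*2.-1 :> nat) && [forall x in raised_sources D, x <= c.1]
     || [exists p in D, consecutive (raised_sources D) c.1 (raise p.1)
                        && (c.2 == raise p.2)])].

Lemma raised_sourcesP n (D : {set chord n.-1}) (x : point n) :
  reflect (x = 0 :> nat \/ exists2 p : chord n.-1, p \in D & x = raise p.1)
          (x \in raised_sources D).
Proof.
rewrite inE; apply: (iffP orP) => -[/eqP|]; first by left.
- by case/exists_inP=> p pD /eqP <-; right; exists p.
- by left.
- by case=> p pD ->; right; apply/exists_inP; exists p.
Qed.

Lemma psi_invP n (D : {set chord n.-1}) (c : chord n) :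
  reflect ([/\ c.1 \in raised_sources D, c.2 = n.*2.-1 :> nat
              & forall x, x \in raised_sources D -> x <= c.1]
           \/ exists2 p : chord n.-1, p \in D &
              consecutive (raised_sources D) c.1 (raise p.1) /\ c.2 = raise p.2)
          (c \in psi_inv D).
Proof.
rewrite [c \in _]inE; apply: (iffP andP).
  case=> cS /orP[/andP[/eqP cmax /forall_inP H]|]; first by left.
  by case/exists_inP=> p pD /andP[cp /eqP cE]; right; exists p.
case=> [[-> -> /forall_inP ->]|[p pD [cp cE]]]; first by rewrite eqxx.
split; first by case/consecutiveP: cp.
by apply/orP; right; apply/exists_inP; exists p; rewrite // cp cE eqxx.
Qed.

(** Passing to next sources loses only the first source, which is 0, and [raised_sources] puts it
    back. *)
Lemma raised_sources_psi n (T : {set chord n}) :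
  one_terminal T -> raised_sources (psi T) = sources T.
Proof.
move=> termT; have diagT := one_terminal_diagram termT.
apply/setP=> x; apply/raised_sourcesP/idP => [[/(sources0 diagT) //|]|xS].
  by case=> p /(psiP termT)[c cT [/consecutiveP[_ ? _ _] _]] ->.
have [x0|x0] := posnP x; [by left | right].
have [q qE] : exists q, raise q = x.
  apply: raiseP => //; case/imsetP: xS => c cT ->.
  exact: (source_lt_max diagT cT).
rewrite -qE in xS *; have [p pT pq] := psi_source termT xS.
by exists p; rewrite ?pq.
Qed.

(** Once the sources are recovered, the last chord is known from its sink 2n - 1, and any other
    chord from its next source, because predecessors are unique. *)
Lemma psiK n (T : {set chord n}) : one_terminal T -> psi_inv (psi T) = T.
Proof.
move=> termT; have diagT := one_terminal_diagram termT.
apply/setP=> c; apply/psi_invP/idP; rewrite raised_sources_psi //.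
  case=> [[/imsetP[d dT cd] cmax Hc]|].
    have ld : last_chord T d by apply/last_chordP; split=> // x /Hc; rewrite cd.
    rewrite (_ : c = d) //; apply: injective_projections => //.
    by apply: val_inj; rewrite /= cmax (last_chord_sink termT ld).
  case=> p /(psiP termT)[d dT [dp dE]] [cp cE].
  rewrite (_ : c = d) //; apply: injective_projections; last by rewrite cE.
  exact: consecutive_injl cp dp.
move=> cT; have [lc|Nl] := boolP (last_chord T c); [left | right].
  have /last_chordP[_ Hc] := lc.
  by split; rewrite ?imset_f // (last_chord_sink termT lc).
exact: psi_next_source.
Qed.

(** * The diagram [psi_inv D] is 1-terminal, and [psi] sends it back to [D] *)

Section Inverse.

Variables (n : nat) (D : {set chord n.-1}).
Hypotheses (n0 : 0 < n) (diagD : chord_diagram D).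
Implicit Types (c d : chord n) (p q : chord n.-1).

Let S := raised_sources D.
Let T := psi_inv D.

Lemma raised_source p : p \in D -> raise p.1 \in S.
Proof. by move=> pD; apply/raised_sourcesP; right; exists p. Qed.

Lemma raised_sink_notin p : p \in D -> raise p.2 \notin S.
Proof.
move=> pD; apply/raised_sourcesP => -[//|[q qD /raise_inj pq]].
by have := sink_notin_sources diagD pD; rewrite pq imset_f.
Qed.

Lemma raised_sources_lt_max x : x \in S -> x < n.*2.-1.
Proof.
by case/raised_sourcesP=> [->|[p _ ->]]; [lia | exact: raise_lt_max].
Qed.

Lemma psi_inv_source c : c \in T -> c.1 \in S.
Proof. by case/psi_invP=> [[]|[p _ [/consecutiveP[]]]]. Qed.

Lemma psi_inv_sink c : c \in T -> c.2 \notin S.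
Proof.
case/psi_invP=> [[_ cmax _]|[p pD [_ ->]]]; last exact: raised_sink_notin.
by apply/negP => /raised_sources_lt_max; rewrite cmax ltnn.
Qed.

Lemma psi_inv_source_ex (x : point n) : x \in S ->
  exists2 c, c \in T & c.1 = x.
Proof.
move=> xS; have n2 : n.*2.-1 < n.*2 by lia.
have [/forall_inP xmax|/forall_inPn[z zS]] := boolP [forall z in S, z <= x].
  by exists (x, Ordinal n2) => //; apply/psi_invP; left.
rewrite -ltnNge => xz; have [y xy] := consecutive_next xS zS xz.
(* The next source is positive, so it comes from a chord [p] of [D], whose sink is the one to
   use. *)
have /consecutiveP[_ /raised_sourcesP[y0|[p pD yE]] xlty _] := xy.
  by rewrite y0 in xlty.
exists (x, raise p.2) => //; apply/psi_invP; right; exists p => //.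
by rewrite -yE.
Qed.

Lemma psi_inv_consecutive p : p \in D ->
  exists2 c, c \in T & consecutive S c.1 (raise p.1) /\ c.2 = raise p.2.
Proof.
move=> pD; have n2 : 0 < n.*2 by lia.
have [x xp] : exists x, consecutive S x (raise p.1).
  apply: (@consecutive_prev _ _ (Ordinal n2)); rewrite ?raised_source //.
  by apply/raised_sourcesP; left.
by exists (x, raise p.2) => //; apply/psi_invP; right; exists p.
Qed.

Lemma psi_inv_lt c : c \in T -> c.1 < c.2.
Proof.
case/psi_invP=> [[cS -> _]|[p pD [/consecutiveP[_ _ cp _] ->]]].
  exact: raised_sources_lt_max.
by apply: ltn_trans cp _; have := chord_lt diagD pD.
Qed.

Lemma psi_inv_chord_diagram : chord_diagram T.
Proof.
apply/chord_diagramP; split=> [|x|]; first exact: psi_inv_lt.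
  have [xS|xS] := boolP (x \in S).
    by have [c cT cx] := psi_inv_source_ex xS; exists c; rewrite ?cx ?eqxx.
  have x0 : 0 < x.
    rewrite lt0n; apply: contraNneq xS => x0.
    by apply/raised_sourcesP; left.
  (* A point outside [S] is either 2n - 1, matched with the largest source, or the raise of a sink
     of [D]. *)
  have [xmax|xmax] := eqVneq (x : nat) n.*2.-1.
    have n2 : 0 < n.*2 by lia.
    have S0 : Ordinal n2 \in S by apply/raised_sourcesP; left.
    case: (@arg_maxnP _ _ (mem S) val S0) => z zS zmax.
    by exists (z, x); [apply/psi_invP; left | rewrite eqxx orbT].
  have [y yx] : exists y, raise y = x.
    by apply: raiseP => //; have := ltn_ord x; lia.
  rewrite -yx in xS *.
  have [p pD py] : exists2 p, p \in D & p.2 = y.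
    apply: notin_sources_sink => //; apply: contra xS => /imsetP[p pD ->].
    exact: raised_source.
  have [c cT [_ cp]] := psi_inv_consecutive pD.
  by exists c; rewrite // cp py eqxx orbT.
have cross c d : c \in T -> d \in T -> c.1 != d.2.
  move=> cT dT; apply/eqP => cd; have := psi_inv_sink dT.
  by rewrite -cd psi_inv_source.
move=> c d x cT dT; case/orP=> /eqP<- /orP[]/eqP dc.
(* Equal sources: the mixed cases fail because the largest source has no successor. *)
- apply: injective_projections; rewrite ?dc //.
  case/psi_invP: cT => [[cS cmax Hc]|[p pD [cp ->]]];
    case/psi_invP: dT => [[dS dmax Hd]|[q qD [dq ->]]].
  + by apply: val_inj; rewrite /= cmax dmax.
  + by case/consecutiveP: dq => _ /Hc; rewrite dc leqNgt => /negPf->.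
  + by case/consecutiveP: cp => _ /Hd; rewrite dc leqNgt => /negPf->.
  + rewrite dc in dq; have /raise_inj pq := consecutive_injr cp dq.
    by rewrite (source_inj diagD pD qD pq).
- by have := cross _ _ cT dT; rewrite dc eqxx.
- by have := cross _ _ dT cT; rewrite dc eqxx.
(* Equal sinks: the mixed cases fail because a raised point stays below 2n - 1. *)
- apply: injective_projections; rewrite ?dc //.
  case/psi_invP: cT dc => [[cS cmax Hc]|[p pD [cp ->]]];
    case/psi_invP: dT => [[dS dmax Hd]|[q qD [dq ->]]] dc.
  + by apply/val_inj/eqP; rewrite /= eqn_leq Hd ?Hc.
  + by have := raise_lt_max q.2; rewrite dc cmax ltnn.
  + by have := raise_lt_max p.2; rewrite -dc dmax ltnn.
  + rewrite (sink_inj diagD qD pD (raise_inj dc)) in dq.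
    exact: consecutive_injl cp dq.
Qed.

Lemma sources_psi_inv : sources T = S.
Proof.
apply/setP=> x; apply/imsetP/idP => [[c cT ->]|].
  exact: psi_inv_source cT.
by case/psi_inv_source_ex=> c cT <-; exists c.
Qed.

(* The chord whose source is the last one before the sink of [c] is a right
   neighbor of [c]: its own sink lies after the next source. *)
Lemma psi_inv_one_terminal : one_terminal T.
Proof.
rewrite /one_terminal psi_inv_chord_diagram; apply/forall_inP=> c cT.
apply/implyP=> /forall_inP tc; apply/last_chordP; split=> //.
rewrite sources_psi_inv; case/psi_invP: (cT) => [[]//|[p pD [cp cE]]].
have /consecutiveP[_ pS lt_cp _] := cp.
have Pp : (raise p.1 \in S) && (raise p.1 < c.2).
  by rewrite pS cE; have := chord_lt diagD pD.
case: (@arg_maxnP _ _ (fun w => (w \in S) && (w < c.2)) val Pp).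
move=> w /andP[wS wc] wmax.
have [d dT dw] := psi_inv_source_ex wS.
case/negP: (tc d dT); rewrite /right_neighbor dw wc.
rewrite (leq_trans lt_cp (wmax _ Pp)) /=.
case/psi_invP: dT => [[_ -> _]|[q qD [dq ->]]].
  by rewrite cE raise_lt_max.
have /consecutiveP[_ qS wq _] := dq; rewrite dw in wq.
have cq : c.2 <= raise q.1.
  rewrite leqNgt; apply/negP => qc.
  have /= := wmax (raise q.1); rewrite qS qc => /(_ isT).
  by move=> /(leq_trans wq); rewrite ltnn.
by apply: leq_ltn_trans cq _; have := chord_lt diagD qD.
Qed.

(** The chord ending at 2n - 1 contributes nothing to [psi T]. Any other chord was built from some
    [q] in [D], and uniqueness of the next source with injectivity of [raise] returns exactly
    [q]. *)
Lemma psi_invK : psi T = D.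
Proof.
apply/setP=> p; apply/(psiP psi_inv_one_terminal)/idP; last first.
  by rewrite sources_psi_inv; apply: psi_inv_consecutive.
rewrite sources_psi_inv => -[c /psi_invP[[_ cmax _]|[q qD [cq cE]]] [cp cE']].
  by have := raise_lt_max p.2; rewrite -cE' cmax ltnn.
have pq1 := raise_inj (consecutive_injr cp cq).
rewrite cE in cE'; have pq2 := raise_inj cE'.
by rewrite (_ : p = q) //; apply: injective_projections.
Qed.

End Inverse.

Theorem theorem8p3 (n : nat) (hn : 2 <= n) :
  [/\ forall T : {set chord n}, one_terminal T -> chord_diagram (psi T),
      forall T1 T2 : {set chord n}, one_terminal T1 -> one_terminal T2 ->
        psi T1 = psi T2 -> T1 = T2
    & forall D : {set chord n.-1}, chord_diagram D ->
        exists2 T : {set chord n}, one_terminal T & psi T = D].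
Proof.
have n0 : 0 < n by apply: ltnW.
split=> [T|T1 T2 term1 term2 eq12|D diagD]; first exact: psi_chord_diagram.
  by rewrite -(psiK term1) eq12 psiK.
by exists (psi_inv D); [apply: psi_inv_one_terminal | apply: psi_invK].
Qed.
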